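(* Let $(V_1, V_2)$ on $\mathcal{H}$ and $(\tilde{V}_1, \tilde{V}_2)$ on $\tilde{\mathcal{H}}$ be irreducible $3$-finite pairs. Then $[V_2^*,V_1]$ has a unique nonzero eigenvalue $\beta_{(V_1,V_2)}$ and $[\tilde V_2^*,\tilde V_1]$ has a unique nonzero eigenvalue $\beta_{(\tilde V_1,\tilde V_2)}$, and $(V_1, V_2)$ and $(\tilde{V}_1, \tilde{V}_2)$ are unitarily equivalent if and only if $\beta_{(V_1, V_2)} = \beta_{(\tilde{V}_1, \tilde{V}_2)}$.
   Context: All Hilbert spaces are complex and separable. An isometric pair is a pair $(V_1,V_2)$ of commuting isometries. An isometry $V$ is a shift if $V^{*m}\to0$ strongly. A BCL pair is an isometric pair with $V_1V_2$ a shift. $[V_2^*,V_1] := V_2^*V_1 - V_1V_2^*$. A compact normal pair is a BCL pair with $[V_2^*,V_1]$ compact and normal. $C(V_1,V_2) := I - V_1V_1^* - V_2V_2^* + V_1V_2V_1^*V_2^*$. A $3$-finite pair is a compact normal pair with $\operatorname{rank} C(V_1,V_2)=3$. Irreducible: no closed subspace other than $\{0\}$ and the whole space invariant under $V_1,V_2,V_1^*,V_2^*$. Two pairs are unitarily equivalent if a single unitary $U$ satisfies $UV_i=\tilde V_iU$, $i=1,2$. *)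

(* Defs.v *)
(* complex numbers R[i] (mathcomp-real-closed) over an
   abstract R : realType (a complete archimedean ordered field, i.e. a copy
   of the reals).  The library has no Hilbert spaces, so an (abstract)
   complex separable Hilbert space is given by a C-vector space H together
   with an inner product satisfying the axioms below. *)
From mathcomp Require Import all_boot all_order all_algebra.
From mathcomp Require Import reals complex.
Set Implicit Arguments. Unset Strict Implicit. Unset Printing Implicit Defensive.
Import Order.TTheory GRing.Theory Num.Theory.
Local Open Scope ring_scope.
Local Open Scope complex_scope.

Section Hilbert.
Variable R : realType.
Local Notation C := (R[i]).
Variable H : lmodType C.
Variable ip : H -> H -> C.

(* norm-square ||x||^2 = <x,x> (a nonnegative real, viewed in C) *)
Definition cvg_to (u : nat -> H) (x : H) : Prop :=
  forall eps : R, 0 < eps ->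
    exists N : nat, forall n : nat, (N <= n)%N ->
      ip (u n - x) (u n - x) < eps%:C.

Definition cauchy (u : nat -> H) : Prop :=
  forall eps : R, 0 < eps ->
    exists N : nat, forall n m : nat, (N <= n)%N -> (N <= m)%N ->
      ip (u n - u m) (u n - u m) < eps%:C.

(* complex separable Hilbert space (inner product linear in the first
   argument, conjugate symmetric, positive definite; complete; separable) *)
Definition hilbert_space : Prop :=
  [/\ (forall (a : C) (x y z : H), ip (a *: x + y) z = a * ip x z + ip y z),
      (forall x y : H, ip y x = ((ip x y)^*)%C),
      (forall x : H, 0 <= ip x x),
      (forall x : H, ip x x = 0 -> x = 0) &
      (forall u : nat -> H, cauchy u -> exists x, cvg_to u x) /\
      (exists d : nat -> H, forall (x : H) (eps : R), 0 < eps ->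
          exists n : nat, ip (x - d n) (x - d n) < eps%:C)].

Definition lin_op (T : H -> H) : Prop :=
  forall (a : C) (x y : H), T (a *: x + y) = a *: T x + T y.

(* S is the Hilbert-space adjoint T^* of T *)
Definition is_adjoint (T S : H -> H) : Prop :=
  forall x y : H, ip (T x) y = ip x (S y).

(* isometry: linear and norm preserving *)
Definition isometry (V : H -> H) : Prop :=
  lin_op V /\ forall x : H, ip (V x) (V x) = ip x x.

(* V (with adjoint Vs) is a shift: V^{*m} -> 0 strongly *)
Definition shift (V Vs : H -> H) : Prop :=
  isometry V /\ forall x : H, cvg_to (fun m => iter m Vs x) 0.

(* compact operator: image of every bounded sequence has a convergent
   subsequence *)
Definition compact_op (T : H -> H) : Prop :=
  lin_op T /\
  forall u : nat -> H, (forall n, ip (u n) (u n) <= 1) ->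
    exists phi : nat -> nat, (forall n, (phi n < phi n.+1)%N) /\
      exists y : H, cvg_to (fun n => T (u (phi n))) y.

(* T has rank n: its range is n-dimensional *)
Definition has_rank (T : H -> H) (n : nat) : Prop :=
  exists e : 'I_n -> H,
    (forall c : 'I_n -> C, \sum_(i < n) c i *: e i = 0 -> forall i, c i = 0) /\
    (forall y : H, (exists x, T x = y) <->
        exists c : 'I_n -> C, y = \sum_(i < n) c i *: e i).

(* [V2^*, V1] := V2^* V1 - V1 V2^* *)
Definition commut (V1 V2s : H -> H) : H -> H :=
  fun x => V2s (V1 x) - V1 (V2s x).

(* C(V1,V2) := I - V1V1^* - V2V2^* + V1V2V1^*V2^* *)
Definition defect (V1 V2 V1s V2s : H -> H) : H -> H :=
  fun x => x - V1 (V1s x) - V2 (V2s x) + V1 (V2 (V1s (V2s x))).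

Definition isometric_pair (V1 V2 : H -> H) : Prop :=
  [/\ isometry V1, isometry V2 & forall x, V1 (V2 x) = V2 (V1 x)].

Definition BCL_pair (V1 V2 V1s V2s : H -> H) : Prop :=
  isometric_pair V1 V2 /\
  shift (fun x => V1 (V2 x)) (fun x => V2s (V1s x)).

(* [V2^*,V1] compact and normal; its adjoint is V1^* V2 - V2 V1^* *)
Definition compact_normal_pair (V1 V2 V1s V2s : H -> H) : Prop :=
  [/\ BCL_pair V1 V2 V1s V2s,
      compact_op (commut V1 V2s) &
      forall x, commut V1 V2s (commut V2 V1s x) =
                commut V2 V1s (commut V1 V2s x)].

Definition three_finite_pair (V1 V2 V1s V2s : H -> H) : Prop :=
  compact_normal_pair V1 V2 V1s V2s /\ has_rank (defect V1 V2 V1s V2s) 3.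

Definition closed_subspace (M : H -> Prop) : Prop :=
  [/\ M 0, (forall (a : C) x y, M x -> M y -> M (a *: x + y)) &
      (forall (u : nat -> H) x, (forall n, M (u n)) -> cvg_to u x -> M x)].

Definition irreducible_pair (V1 V2 V1s V2s : H -> H) : Prop :=
  forall M : H -> Prop, closed_subspace M ->
    (forall x, M x -> [/\ M (V1 x), M (V2 x), M (V1s x) & M (V2s x)]) ->
    (forall x, M x -> x = 0) \/ (forall x, M x).

Definition eigenvalue (T : H -> H) (b : C) : Prop :=
  exists x : H, x <> 0 /\ T x = b *: x.

Definition unique_nonzero_eigenvalue (T : H -> H) (b : C) : Prop :=
  b <> 0 /\ eigenvalue T b /\ forall b', b' <> 0 -> eigenvalue T b' -> b' = b.

End Hilbert.

(* unitary equivalence of (V1,V2) on H and (W1,W2) on K *)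
Definition unitarily_equivalent (R : realType) (H K : lmodType R[i])
    (ipH : H -> H -> R[i]) (ipK : K -> K -> R[i])
    (V1 V2 : H -> H) (W1 W2 : K -> K) : Prop :=
  exists U : H -> K,
    [/\ (forall (a : R[i]) x y, U (a *: x + y) = a *: U x + U y),
        (forall x y, ipK (U x) (U y) = ipH x y),
        (forall z, exists x, U x = z),
        (forall x, U (V1 x) = W1 (U x)) &
        (forall x, U (V2 x) = W2 (U x))].

(* Main.v *)
(* Let N = [V2^*,V1] and E = ker V1^* /\ ker V2^*.  Normality forces N and N^* to
   vanish on ran V1 and on ran V2, so N preserves E; the defect operator C is the
   identity on E, which is therefore finite dimensional, and E <> 0.  Pick a unit
   eigenvector f of N in E, with eigenvalue beta.  Then V1^* and V2^* map each
   V1^m V2^n f to a multiple of another such vector, with coefficients depending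
   on beta only.  By irreducibility these vectors are total, hence
   N = beta <., f> f, and beta = 0 would give rank C = 1.  Their Gram matrix
   depends on beta only, so two pairs with equal beta are intertwined by the
   unitary V1^m V2^n f |-> W1^m W2^n g. *)
Require Import Defs.
From mathcomp Require Import all_boot all_order all_algebra.
From mathcomp Require Import reals complex boolp.
From mathcomp Require Import ring lra.
Import Order.TTheory GRing.Theory Num.Theory.
Local Open Scope ring_scope.
Set Implicit Arguments. Unset Strict Implicit. Unset Printing Implicit Defensive.

(** * Eigenvectors of an operator on a finite-dimensional invariant subspace *)

Section LinearOperator.
Variables (R : realType) (H : lmodType R[i]) (T : H -> H).
Hypothesis linT : lin_op T.

Lemma lin_opD x y : T (x + y) = T x + T y.
Proof. by have := linT 1 x y; rewrite !scale1r. Qed.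

Lemma lin_op0 : T 0 = 0.
Proof. by apply: (addrI (T 0)); rewrite -lin_opD !addr0. Qed.

Lemma lin_opZ a x : T (a *: x) = a *: T x.
Proof. by have := linT a x 0; rewrite lin_op0 !addr0. Qed.

Lemma lin_opB x y : T (x - y) = T x - T y.
Proof. by rewrite -scaleN1r lin_opD lin_opZ scaleN1r. Qed.

Let peval (p : {poly R[i]}) (x : H) := \sum_(i < size p) p`_i *: iter i T x.

Lemma peval_widen (p : {poly R[i]}) x n : (size p <= n)%N ->
  peval p x = \sum_(i < n) p`_i *: iter i T x.
Proof.
move=> le_pn; rewrite /peval -!(big_mkord xpredT (fun i => p`_i *: iter i T x)).
rewrite [RHS](big_cat_nat _ le_pn) //= [X in _ + X]big1_seq ?addr0 // => i /=.
by rewrite mem_index_iota => /andP[le_pi _]; rewrite nth_default ?scale0r.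
Qed.

Lemma peval_mulXsub (q : {poly R[i]}) a x :
  peval (q * ('X - a%:P)) x = peval q (T x - a *: x).
Proof.
have iterB i : iter i T (T x - a *: x) = iter i.+1 T x - a *: iter i T x.
  by elim: i => [|i IHi] //=; rewrite IHi lin_opB lin_opZ.
have [->|q0] := eqVneq q 0; first by rewrite mul0r /peval size_poly0 !big_ord0.
have szq : (size (q * ('X - a%:P))%R <= (size q).+1)%N.
  by rewrite size_Mmonic ?monicXsubC // size_XsubC addn2.
rewrite (peval_widen _ szq) /peval.
under [RHS]eq_bigr => i _ do rewrite iterB scalerBr scalerA.
rewrite sumrB mulrBr.
under eq_bigr => i _ do rewrite coefB coefMX coefMC scalerBl.
rewrite sumrB big_ord_recl /= scale0r add0r; congr (_ - _).
by rewrite big_ord_recr /= nth_default // mul0r scale0r addr0.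
Qed.

(** Induction on the degree: write p = q(X - a) with a a root of p. Either x is an eigenvector for
    a, or Tx - ax is a nonzero vector of [E] annihilated by q(T). *)
Lemma eigenvector_of_annihilator (E : H -> Prop)
    (stabE : forall a x, E x -> E (T x - a *: x)) (p : {poly R[i]}) x :
  E x -> x <> 0 -> p != 0 -> peval p x = 0 ->
  exists a f, [/\ E f, f <> 0 & T f = a *: f].
Proof.
move: {2}(size p) (leqnn (size p)) => n; elim: n p x => [|n IHn] p x.
  by rewrite size_poly_leq0 => ->.
move=> szp Ex x0 p0 px0.
have [sz1|/closed_rootP[a]] := eqVneq (size p) 1%N.
  have [c c0 pE] := elimT (size_poly1P _) (introT eqP sz1).
  move: px0; rewrite /peval sz1 big_ord1 pE coefC /= => /eqP.
  by rewrite scaler_eq0 (negPf c0) /= => /eqP.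
move/factor_theorem => [q pE].
have q0 : q != 0 by apply: contra_neq p0 => q0; rewrite pE q0 mul0r.
have [Tx|Tx] := pselect (T x - a *: x = 0).
  by exists a, x; split => //; exact/subr0_eq.
apply: (IHn q (T x - a *: x)) => //; last by rewrite -peval_mulXsub -pE.
  by move: szp; rewrite pE size_Mmonic ?monicXsubC // size_XsubC addn2.
exact: stabE.
Qed.

Lemma eigenvector_of_finite_dim (E : H -> Prop) n (e : 'I_n -> H) x
    (stabE : forall a x, E x -> E (T x - a *: x))
    (spanE : forall x, E x -> exists c : 'I_n -> R[i], x = \sum_i c i *: e i) :
  E x -> x <> 0 -> exists a f, [/\ E f, f <> 0 & T f = a *: f].
Proof.
move=> Ex x0.
have Eiter i : E (iter i T x).
  elim: i => [|i IHi] //=.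
  by have := stabE 0 _ IHi; rewrite scale0r subr0.
have [c cE] := choice (fun i => spanE _ (Eiter i)).
(* The rows are coordinates of x, Tx, ..., T^n x in the n vectors [e]: one row too many, so a
   nonzero row vector kills [A] on the left, and its entries are the coefficients of an annihilating
   polynomial. *)
pose A : 'M[R[i]]_(n.+1, n) := \matrix_(i, j) c i j.
have : kermx A != 0.
  rewrite kermx_eq0 /row_free neq_ltn; apply/orP; left.
  by rewrite ltnS rank_leq_col.
move/rowV0Pn => [v /sub_kermxP vA v0].
apply: (@eigenvector_of_annihilator E stabE (rVpoly v) x) => //.
  by apply: contra v0 => /eqP v0; rewrite -[v]rVpolyK v0 linear0.
rewrite (@peval_widen _ _ n.+1) ?size_poly //.
under eq_bigr => i _ do rewrite cE coef_rVpoly_ord scaler_sumr.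
rewrite exchange_big big1 // => j _ /=.
under eq_bigr => i _ do rewrite scalerA.
rewrite -scaler_suml.
have := congr1 (fun M : 'rV_n => M 0 j) vA; rewrite !mxE => vAj.
by under eq_bigr => i _ do [have -> : c i j = A i j by rewrite mxE]; rewrite vAj scale0r.
Qed.

End LinearOperator.

Lemma sum_delta (R : nzRingType) (H : lmodType R) n (e : 'I_n -> H) i :
  exists c : 'I_n -> R, e i = \sum_j c j *: e j.
Proof.
exists (fun j => (j == i)%:R); rewrite (bigD1 i) //= eqxx scale1r big1 ?addr0 //.
by move=> j /negPf ->; rewrite scale0r.
Qed.

(** * Inner products, convergence, isometries and adjoints *)

Section InnerProduct.
Variables (R : realType) (H : lmodType R[i]) (ip : H -> H -> R[i]).
Hypothesis hs : hilbert_space ip.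

Lemma ipC x y : ip y x = (ip x y)^*. Proof. by case: hs. Qed.

Lemma ip_ge0 x : 0 <= ip x x. Proof. by case: hs. Qed.

Lemma ip_eq0 x : ip x x = 0 -> x = 0. Proof. by case: hs => _ _ _ + _; exact. Qed.

Lemma ipDl x y z : ip (x + y) z = ip x z + ip y z.
Proof. by case: hs => ipl *; rewrite -[x]scale1r ipl mul1r scale1r. Qed.

Lemma ip0l z : ip 0 z = 0.
Proof. by apply: (addrI (ip 0 z)); rewrite -ipDl !addr0. Qed.

Lemma ipZl a x z : ip (a *: x) z = a * ip x z.
Proof. by case: hs => ipl *; rewrite -[a *: x]addr0 ipl ip0l addr0. Qed.

Lemma ipBl x y z : ip (x - y) z = ip x z - ip y z.
Proof. by rewrite -scaleN1r ipDl ipZl mulN1r. Qed.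

Lemma ip0r z : ip z 0 = 0.
Proof. by rewrite ipC ip0l conjC0. Qed.

Lemma ipDr x y z : ip z (x + y) = ip z x + ip z y.
Proof. by rewrite ipC ipDl rmorphD /= -!ipC. Qed.

Lemma ipZr a x z : ip z (a *: x) = a^* * ip z x.
Proof. by rewrite ipC ipZl rmorphM /= -ipC. Qed.

Lemma ipBr x y z : ip z (x - y) = ip z x - ip z y.
Proof. by rewrite ipC ipBl rmorphB /= -!ipC. Qed.

Lemma ip_inj x y : (forall z, ip x z = ip y z) -> x = y.
Proof. by move=> xy; apply/subr0_eq/ip_eq0; rewrite ipBl xy subrr. Qed.

Lemma ip_real x : ip x x = (complex.Re (ip x x))%:C%C.
Proof. by rewrite RRe_real // ger0_real // ip_ge0. Qed.

Lemma ip_CauchySchwarz x y : `|ip x y| ^+ 2 <= ip x x * ip y y.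
Proof.
have [y0|y0] := eqVneq (ip y y) 0.
  by rewrite (ip_eq0 y0) !ip0r normr0 expr0n mulr0.
have y_gt0 : 0 < ip y y by rewrite lt0r y0 ip_ge0.
(* Up to the factor [ip y y], this vector is the component of x orthogonal to y. *)
have := ip_ge0 (ip y y *: x - ip x y *: y).
rewrite !(ipBl, ipBr, ipZl, ipZr) (ipC x y) -(ipC y y) normCK.
set e := (X in 0 <= X).
have -> : e = ip y y * (ip x x * ip y y - ip x y * (ip x y)^*) by rewrite /e; ring.
by rewrite pmulr_rge0 // subr_ge0.
Qed.

Lemma ip_parallelogram x y :
  ip (x - y) (x - y) + ip (x + y) (x + y) = ip x x + ip x x + (ip y y + ip y y).
Proof. rewrite !(ipBl, ipBr, ipDl, ipDr); ring. Qed.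

Lemma cvg_ip u x z (eps : R) : cvg_to ip u x -> 0 < eps ->
  exists N, forall n, (N <= n)%N -> `|ip (u n - x) z| < eps%:C%C.
Proof.
move=> ux eps0; set A := complex.Re (ip z z).
have A0 : 0 <= A by rewrite -lecR -ip_real ip_ge0.
(* The tolerance bounds a squared norm, hence the square; the [+ 1] covers z = 0. *)
have d0 : 0 < eps ^+ 2 / (A + 1) by rewrite divr_gt0 ?exprn_gt0 // ltr_wpDl.
have [N uN] := ux _ d0; exists N => n /uN un.
rewrite -(@ltr_pXn2r _ 2) ?nnegrE ?normr_ge0 ?ler0c ?(ltW eps0) //.
apply: le_lt_trans (ip_CauchySchwarz _ _) _.
rewrite (ip_real z) -/A -rmorphXn /=.
apply: (@le_lt_trans _ _ ((eps ^+ 2 / (A + 1))%:C%C * A%:C%C)).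
  by rewrite ler_wpM2r ?ler0c // ltW.
rewrite -rmorphM /= ltcR mulrAC ltr_pdivrMr; last by rewrite ltr_wpDl.
by rewrite ltr_pM2l ?exprn_gt0 // ltrDl.
Qed.

Lemma cvg_cauchy u x : cvg_to ip u x -> cauchy ip u.
Proof.
(* Squared norms satisfy only |a - b|^2 <= 2|a|^2 + 2|b|^2, by the parallelogram law; hence the
   quarter. *)
move=> ux eps eps0; have e4 : 0 < eps / 4%:R by rewrite divr_gt0.
have [N uN] := ux _ e4; exists N => n m /uN un /uN um.
have -> : u n - u m = (u n - x) - (u m - x) by rewrite opprB addrA subrK.
apply: (@le_lt_trans _ _ (ip (u n - x) (u n - x) + ip (u n - x) (u n - x)
  + (ip (u m - x) (u m - x) + ip (u m - x) (u m - x)))).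
  by rewrite -ip_parallelogram lerDl ip_ge0.
have -> : eps%:C%C = (eps / 4%:R)%:C%C + (eps / 4%:R)%:C%C
   + ((eps / 4%:R)%:C%C + (eps / 4%:R)%:C%C) by rewrite -!rmorphD /=; congr (_%:C%C); lra.
by rewrite !ltrD.
Qed.

Lemma cvg_cst x : cvg_to ip (fun=> x) x.
Proof. by move=> eps eps0; exists 0%N => n _; rewrite subrr ip0l ltcR. Qed.

(** Polarization: the sesquilinear form [d] vanishes on the diagonal, and the scalars 1 and i
    separate [d x y] from [d y x]. *)
Lemma isometry_ip V x y : Defs.isometry ip V -> ip (V x) (V y) = ip x y.
Proof.
move=> [linV normV]; set d := fun x y => ip (V x) (V y) - ip x y.
have d0 z : d z z = 0 by rewrite /d normV subrr.
have dZ a : a * d x y + a^* * d y x = 0.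
  have := d0 (a *: x + y); rewrite /d (lin_opD linV) (lin_opZ linV).
  rewrite !(ipDl, ipDr, ipZl, ipZr) !normV => <-; ring.
have d1 := dZ 1; have di := dZ 'i.
suff : d x y = 0 by move/subr0_eq.
have i0 : 'i != 0 :> R[i] := neq0Ci _.
have ci : ('i : R[i])^* = - 'i := conjCi _.
move: d1 di; rewrite ci conjC1 !mul1r => d1.
rewrite mulNr -mulrBr => /eqP; rewrite mulf_eq0 (negPf i0) /= => /eqP di.
have : d x y + d x y = 0 by rewrite -[RHS]addr0 -{1}d1 -di; ring.
by rewrite -mulr2n => /eqP; rewrite mulrn_eq0 /= => /eqP.
Qed.

Section Adjoint.
Variables T S : H -> H.
Hypothesis adjT : is_adjoint ip T S.

Lemma adjoint_sym x y : ip (S x) y = ip x (T y).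
Proof. by rewrite ipC -adjT -ipC. Qed.

Lemma adjoint_lin : lin_op S.
Proof.
by move=> a x y; apply: ip_inj => z; rewrite adjoint_sym !(ipDl, ipZl) !adjoint_sym.
Qed.

Lemma adjoint_isometryK x : Defs.isometry ip T -> S (T x) = x.
Proof. by move=> isoT; apply: ip_inj => z; rewrite adjoint_sym isometry_ip. Qed.

End Adjoint.
End InnerProduct.

Lemma cvg_ip_eq (R : realType) (H K : lmodType R[i]) (ipH : H -> H -> R[i])
    (ipK : K -> K -> R[i]) (hsH : hilbert_space ipH) (hsK : hilbert_space ipK)
    u x v y a b :
  cvg_to ipH u x -> cvg_to ipK v y -> (forall n, ipH (u n) a = ipK (v n) b) ->
  ipH x a = ipK y b.
Proof.
move=> ux vy uv; apply: subr0_eq; apply/eqP; rewrite -normr_eq0.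
set z := `|_|; have z0 : 0 <= z by rewrite normr_ge0.
have zE : z = (complex.Re z)%:C%C by rewrite RRe_real // ger0_real.
rewrite -[_ == _]negbK; apply/negP => zn0.
have r0 : 0 < complex.Re z / 2%:R.
  by rewrite divr_gt0 // -ltcR -zE lt0r zn0.
have [N1 uN] := cvg_ip hsH a ux r0; have [N2 vN] := cvg_ip hsK b vy r0.
have {uN} := uN _ (leq_maxl N1 N2); have {vN} := vN _ (leq_maxr N1 N2).
set n := maxn _ _ => vn un; have := ltrD un vn.
have -> : (complex.Re z / 2%:R)%:C%C + (complex.Re z / 2%:R)%:C%C = z.
  by rewrite -rmorphD /= -splitr -zE.
rewrite (ipBl hsH) (ipBl hsK) uv -[X in _ + X]normrN => /(le_lt_trans (ler_normD _ _)).
by rewrite opprB addrC addrA subrK distrC ltxx.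
Qed.

(** As both adjoints kill [f], the last two equations say that [f] is an eigenvector of [V2^*,V1]
    and of its adjoint. *)
Definition joint_eigenvector (R : realType) (H : lmodType R[i]) (ip : H -> H -> R[i])
    (V1 V2 V1s V2s : H -> H) (beta : R[i]) (f : H) : Prop :=
  [/\ ip f f = 1, V1s f = 0, V2s f = 0,
      V2s (V1 f) = beta *: f & V1s (V2 f) = beta^* *: f].

(** * The cross-commutator of a compact normal pair *)

Section CompactNormalPair.
Variables (R : realType) (H : lmodType R[i]) (ip : H -> H -> R[i]).
Variables V1 V2 V1s V2s : H -> H.
Hypothesis hs : hilbert_space ip.
Hypotheses (adj1 : is_adjoint ip V1 V1s) (adj2 : is_adjoint ip V2 V2s).
Hypothesis cnp : compact_normal_pair ip V1 V2 V1s V2s.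

Let iso1 : Defs.isometry ip V1. Proof. by case: cnp => -[[]]. Qed.
Let iso2 : Defs.isometry ip V2. Proof. by case: cnp => -[[]]. Qed.
Let V12 x : V1 (V2 x) = V2 (V1 x). Proof. by case: cnp => -[[]]. Qed.
Let normal x :
  commut V1 V2s (commut V2 V1s x) = commut V2 V1s (commut V1 V2s x).
Proof. by case: cnp. Qed.
Let lin1 : lin_op V1 := proj1 iso1.
Let lin2 : lin_op V2 := proj1 iso2.
Let lin1s : lin_op V1s := adjoint_lin hs adj1.
Let lin2s : lin_op V2s := adjoint_lin hs adj2.
Let K1 x : V1s (V1 x) = x := adjoint_isometryK hs adj1 x iso1.
Let K2 x : V2s (V2 x) = x := adjoint_isometryK hs adj2 x iso2.
Let adj1s := adjoint_sym hs adj1.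
Let adj2s := adjoint_sym hs adj2.

Local Notation N := (commut V1 V2s).
Local Notation Ns := (commut V2 V1s).
Local Notation D := (defect V1 V2 V1s V2s).
Local Notation E := (fun x => V1s x = 0 /\ V2s x = 0).

Lemma adjoint_comm x : V1s (V2s x) = V2s (V1s x).
Proof. by apply: (ip_inj hs) => z; rewrite adj1s adj2s -V12 -adj1s -adj2s. Qed.

Lemma commut_lin : lin_op N.
Proof.
move=> a x y; rewrite /commut !(lin_opD lin1, lin_opD lin2s, lin_opZ lin1, lin_opZ lin2s).
by rewrite scalerBr opprD addrACA.
Qed.

Lemma commut_adj x y : ip (N x) y = ip x (Ns y).
Proof. by rewrite /commut (ipBl hs) (ipBr hs) adj2s !adj1 adj2s. Qed.

Lemma commut_V2 x : N (V2 x) = 0.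
Proof. by rewrite /commut K2 V12 K2 subrr. Qed.

Lemma commut_adj_V1 x : Ns (V1 x) = 0.
Proof. by rewrite /commut K1 -V12 K1 subrr. Qed.

Lemma commut_norm x : ip (Ns x) (Ns x) = ip (N x) (N x).
Proof. by rewrite -commut_adj normal [RHS]commut_adj (ipC hs) -commut_adj -(ipC hs). Qed.

(** Commutation alone gives N V2 = 0 and N^* V1 = 0; normality equates the norms of Nx and N^*x,
    which carries each vanishing over to the other operator. *)
Lemma commut_V1 x : N (V1 x) = 0.
Proof. by apply/(ip_eq0 hs); rewrite -commut_norm commut_adj_V1 (ip0l hs). Qed.

Lemma commut_adj_V2 x : Ns (V2 x) = 0.
Proof. by apply/(ip_eq0 hs); rewrite commut_norm commut_V2 (ip0l hs). Qed.

(** [E] is the orthogonal complement of ran V1 + ran V2, on which N^* vanishes. *)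
Lemma commut_range x : E (N x).
Proof.
split; apply: (ip_inj hs) => z.
  by rewrite adj1s commut_adj commut_adj_V1 (ip0l hs) (ip0r hs).
by rewrite adj2s commut_adj commut_adj_V2 (ip0l hs) (ip0r hs).
Qed.

Lemma commut_stable a x : E x -> E (N x - a *: x).
Proof.
move=> [x1 x2]; have [n1 n2] := commut_range x.
by rewrite (lin_opB lin1s) (lin_opB lin2s) (lin_opZ lin1s) (lin_opZ lin2s)
  n1 n2 x1 x2 scaler0 subr0.
Qed.

Lemma defect_joint_kernel x : E x -> D x = x.
Proof.
move=> [x1 x2]; rewrite /defect x1 x2 (lin_op0 lin1s).
by rewrite !(lin_op0 lin1, lin_op0 lin2) !subr0 addr0.
Qed.

Lemma commut_adj_eq0 : (forall x, N x = 0) -> forall x, Ns x = 0.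
Proof. by move=> N0 x; apply/(ip_eq0 hs); rewrite commut_norm N0 (ip0l hs). Qed.

(* When the cross-commutator vanishes the pair doubly commutes and the defect
   operator is the projection [(I - V1 V1^* )(I - V2 V2^* )]. *)
Lemma defect_range_doubly_commuting x : (forall x, N x = 0) -> E (D x).
Proof.
move=> N0; have Ns0 := commut_adj_eq0 N0.
have c1 y : V1s (V2 y) = V2 (V1s y) by apply: subr0_eq; exact: Ns0.
have c2 y : V2s (V1 y) = V1 (V2s y) by apply: subr0_eq; exact: N0.
rewrite /defect; split.
  rewrite (lin_opD lin1s) !(lin_opB lin1s) !K1 c1 subrr add0r.
  by rewrite adjoint_comm addNr.
rewrite (lin_opD lin2s) !(lin_opB lin2s) V12 !K2 c2.
by rewrite adjoint_comm addrAC subrK subrr.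
Qed.

Lemma exists_joint_kernel : (exists x, D x <> 0) -> exists x, E x /\ x <> 0.
Proof.
move=> [x Dx0]; have [N0|] := pselect (forall x, N x = 0).
  by exists (D x); split => //; exact: defect_range_doubly_commuting.
by move/existsNP => [y Ny0]; exists (N y); split => //; exact: commut_range.
Qed.

(** The squared norm of the difference expands to 0, since N^*f and Nf have equal norms. *)
Lemma commut_adj_eigenvector b f : N f = b *: f -> Ns f = b^* *: f.
Proof.
move=> Nf; apply/subr0_eq/(ip_eq0 hs).
have ff : ip (Ns f) f = b^* * ip f f.
  by rewrite (ipC hs) -commut_adj Nf (ipZl hs) rmorphM /= -(ipC hs).
have := commut_norm f; rewrite Nf; move: (Ns f) ff => g gf gg.
rewrite !(ipBl hs, ipBr hs, ipZl hs, ipZr hs) gg gf (ipC hs g) gf.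
rewrite !(ipZl hs, ipZr hs) rmorphM /= !conjCK -(ipC hs); ring.
Qed.

Lemma exists_joint_eigenvector n : has_rank D n.+1 ->
  exists beta f, joint_eigenvector ip V1 V2 V1s V2s beta f.
Proof.
move=> [e [free_e eD]].
have [x [Ex x0]] : exists x, E x /\ x <> 0.
  apply: exists_joint_kernel; have [x xE] : exists x, D x = e ord0.
    by apply/eD; exact: sum_delta.
  (* A vector of a free family is nonzero, so the defect operator is nonzero. *)
  exists x; rewrite xE => e0.
  have := free_e (fun j => (j == ord0)%:R); rewrite (bigD1 ord0) //= e0 scaler0 add0r.
  rewrite big1 => [|j /negPf ->]; last by rewrite scale0r.
  by move=> /(_ erefl ord0) /eqP; rewrite oner_eq0.
have spanE y : E y -> exists c : 'I_n.+1 -> R[i], y = \sum_i c i *: e i.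
  by move=> Ey; apply/eD; exists y; exact: defect_joint_kernel.
have [b [f [Ef f0 Nf]]] := eigenvector_of_finite_dim commut_lin commut_stable spanE Ex x0.
have ff0 : ip f f != 0 by apply/eqP => /(ip_eq0 hs).
pose a := (sqrtC (ip f f))^-1; exists b, (a *: f).
have Nsf := commut_adj_eigenvector Nf; move: Ef => [f1 f2].
move: Nf Nsf; rewrite /commut f1 f2 !(lin_op0 lin1, lin_op0 lin2) !subr0 => Nf Nsf.
split.
- have s0 : 0 <= sqrtC (ip f f) by rewrite sqrtC_ge0 ip_ge0.
  rewrite (ipZl hs) (ipZr hs) /a conj_Creal ?rpredV ?ger0_real // mulrA -invfM -expr2.
  by rewrite sqrtCK mulVf.
- by rewrite (lin_opZ lin1s) f1 scaler0.
- by rewrite (lin_opZ lin2s) f2 scaler0.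
- by rewrite (lin_opZ lin1) (lin_opZ lin2s) Nf !scalerA mulrC.
- by rewrite (lin_opZ lin2) (lin_opZ lin1s) Nsf !scalerA mulrC.
Qed.

(** * The orbit of a joint eigenvector and its totality *)

Section Orbit.
Variables (beta : R[i]) (f : H).
Hypothesis ev : joint_eigenvector ip V1 V2 V1s V2s beta f.

Definition orbit_vec m n := iter m V1 (iter n V2 f).

Lemma orbit_vecV1 m n : V1 (orbit_vec m n) = orbit_vec m.+1 n.
Proof. by []. Qed.

Lemma orbit_vecV2 m n : V2 (orbit_vec m n) = orbit_vec m n.+1.
Proof. by rewrite /orbit_vec; elim: m => [|m IHm] //=; rewrite -IHm V12. Qed.

(** V1^* acts on the orbit as a weighted backward shift: weight 1 when a factor V1 cancels,
    conjugate of [beta] on the edge m = 0, and 0 at [f] itself. *)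
Definition orbit_coef1 (m n : nat) : R[i] :=
  if m is 0%N then if n is 0%N then 0 else beta^* else 1.

Definition orbit_coef2 (m n : nat) : R[i] :=
  if n is 0%N then if m is 0%N then 0 else beta else 1.

Lemma orbit_vecV1s m n : V1s (orbit_vec m n) =
  orbit_coef1 m n *: orbit_vec m.-1 (if m is 0%N then n.-1 else n).
Proof.
case: ev => _ f1 _ _ f12.
case: m => [|m] /=; last by rewrite scale1r K1.
case: n => [|n] /=; first by rewrite scale0r f1.
rewrite /orbit_vec /=; elim: n => [|n IHn] //=.
(* N^* V2 = 0 lets V1^* pass a factor V2 as long as another V2 follows; the last one is absorbed by
   V1^* V2 f. *)
have /subr0_eq -> := commut_adj_V2 (iter n V2 f).
by rewrite IHn (lin_opZ lin2).
Qed.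

Lemma orbit_vecV2s m n : V2s (orbit_vec m n) =
  orbit_coef2 m n *: orbit_vec (if n is 0%N then m.-1 else m) n.-1.
Proof.
case: ev => _ _ f2 f21 _.
case: n => [|n] /=; last by rewrite scale1r -orbit_vecV2 K2.
case: m => [|m] /=; first by rewrite scale0r f2.
rewrite /orbit_vec /=; elim: m => [|m IHm] //=.
have /subr0_eq -> := commut_V1 (iter m V1 f).
by rewrite IHm (lin_opZ lin1).
Qed.

Lemma ip_eigenvector_orbit m n :
  ip f (orbit_vec m n) = ((m == 0%N) && (n == 0%N))%:R.
Proof.
case: ev => ff f1 f2 _ _.
case: m => [|m]; last by rewrite -orbit_vecV1 -adj1s f1 (ip0l hs).
by case: n => [|n] //; rewrite -orbit_vecV2 -adj2s f2 (ip0l hs).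
Qed.

Hypothesis irr : irreducible_pair ip V1 V2 V1s V2s.

(** The orthogonal complement of the orbit is closed and reducing, because all four operators send
    orbit vectors to multiples of orbit vectors; it omits [f], so irreducibility makes it zero. *)
Lemma orbit_total x : (forall m n, ip x (orbit_vec m n) = 0) -> x = 0.
Proof.
pose M x := forall m n, ip x (orbit_vec m n) = 0.
have : (forall x, M x -> x = 0) \/ (forall x, M x).
  apply: (irr (M := M)); first split.
  - by move=> m n; rewrite (ip0l hs).
  - by move=> a y z My Mz m n; rewrite (ipDl hs) (ipZl hs) My Mz mulr0 addr0.
  - move=> u y Mu uy m n.
    rewrite (cvg_ip_eq hs hs uy (cvg_cst hs 0) (b := 0)) ?(ip0l hs) // => k.
    exact: Mu.
  move=> y My; split => m n.
  - by rewrite adj1 orbit_vecV1s (ipZr hs) My mulr0.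
  - by rewrite adj2 orbit_vecV2s (ipZr hs) My mulr0.
  - by rewrite adj1s orbit_vecV1 My.
  - by rewrite adj2s orbit_vecV2 My.
case=> [M0|MT]; first exact: M0.
have := MT f 0%N 0%N; rewrite ip_eigenvector_orbit => /eqP.
by rewrite oner_eq0.
Qed.

Lemma eigenvector_commut_adj : Ns f = beta^* *: f.
Proof. by case: ev => _ f1 _ _ f12; rewrite /commut f12 f1 (lin_op0 lin2) subr0. Qed.

Lemma eigenvector_commut : N f = beta *: f.
Proof. by case: ev => _ _ f2 f21 _; rewrite /commut f21 f2 (lin_op0 lin1) subr0. Qed.

(** By totality it suffices to pair with orbit vectors. Both sides are orthogonal to ran V1 and ran
    V2, which leaves only [f]. *)
Lemma commut_rank1 x : N x = (beta * ip x f) *: f.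
Proof.
apply/subr0_eq/orbit_total => m n.
rewrite (ipBl hs) (ipZl hs) ip_eigenvector_orbit commut_adj.
case: m => [|m]; last by rewrite -orbit_vecV1 commut_adj_V1 (ip0r hs) mulr0 subr0.
case: n => [|n]; last by rewrite -orbit_vecV2 commut_adj_V2 (ip0r hs) mulr0 subr0.
by rewrite eigenvector_commut_adj (ipZr hs) conjCK mulr1 subrr.
Qed.

(** Now N = 0, so the range of the defect operator lies in [E] and pairing with [f] is again the
    only test. *)
Lemma defect_rank1 x : beta = 0 -> D x = ip x f *: f.
Proof.
move=> b0; have N0 y : N y = 0 by rewrite commut_rank1 b0 mul0r scale0r.
have [d1 d2] := defect_range_doubly_commuting x N0.
case: ev => ff f1 f2 _ _.
apply/subr0_eq/orbit_total => m n.
rewrite (ipBl hs) (ipZl hs) ip_eigenvector_orbit.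
case: m => [|m]; last by rewrite -orbit_vecV1 -adj1s d1 (ip0l hs) mulr0 subr0.
case: n => [|n]; last by rewrite -orbit_vecV2 -adj2s d2 (ip0l hs) mulr0 subr0.
have -> : orbit_vec 0 0 = f by [].
rewrite mulr1 /defect (ipDl hs) !(ipBl hs) !adj1 !adj2 f1 f2.
by rewrite (lin_op0 lin2s) !(ip0r hs) !subr0 addr0 subrr.
Qed.

Lemma eigenvalue_neq0 n : has_rank D n.+2 -> beta <> 0.
Proof.
move=> [e [free_e eD]] b0.
have De i : exists c, e i = c *: f.
  have [x <-] : exists x, D x = e i by apply/eD; exact: sum_delta.
  by exists (ip x f); rewrite defect_rank1.
have [c0 e0] := De ord0; have [c1 e1] := De (lift ord0 ord0).
(* Two members of a free family would be multiples [c0], [c1] of the same vector. The pair (c1, -c0)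
   forces c1 = 0, and then (0, 1) is a forbidden relation. *)
have dep a b : a * c0 + b * c1 = 0 -> a = 0 /\ b = 0.
  move=> ab.
  have := free_e (fun j : 'I_n.+2 =>
    if val j is 0%N then a else if val j is 1%N then b else 0).
  rewrite !big_ord_recl big1 /= => [|j _]; last by rewrite scale0r.
  rewrite e0 e1 addr0 !scalerA -scalerDl ab scale0r => /(_ erefl) h.
  by split; [exact: (h ord0)|exact: (h (lift ord0 ord0))].
have [|c10 _] := dep c1 (- c0); first by ring.
have [|_ /eqP] := dep 0 1; first by rewrite c10; ring.
by rewrite oner_eq0.
Qed.

Lemma unique_eigenvalue n : has_rank D n.+2 -> unique_nonzero_eigenvalue N beta.
Proof.
move=> rk; have b0 := eigenvalue_neq0 rk; split => //.
have ff : ip f f = 1 by case: ev.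
have f0 : f <> 0 by move=> f0; move/eqP: ff; rewrite f0 (ip0l hs) eq_sym oner_eq0.
split; first by exists f; split => //; exact: eigenvector_commut.
move=> b' b'0 [x [x0]]; rewrite commut_rank1 => xE.
have xf : ip x f <> 0.
  move=> xf; move: xE; rewrite xf mulr0 scale0r => /esym/eqP.
  by rewrite scaler_eq0 => /orP[] /eqP.
(* Pairing with the unit vector [f] leaves beta <x,f> = b' <x,f>, and <x,f> cancels. *)
have := congr1 (fun z => ip z f) xE; rewrite !(ipZl hs) ff mulr1 => /mulIf -> //.
exact/eqP.
Qed.

End Orbit.
End CompactNormalPair.

(** * The graph relating the orbits of two pairs with a common eigenvalue *)

Section EqualEigenvalues.
Variables (R : realType) (H K : lmodType R[i]).
Variables (ipH : H -> H -> R[i]) (ipK : K -> K -> R[i]).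
Variables (V1 V2 V1s V2s : H -> H) (W1 W2 W1s W2s : K -> K).
Hypotheses (hsH : hilbert_space ipH) (hsK : hilbert_space ipK).
Hypotheses (adjV1 : is_adjoint ipH V1 V1s) (adjV2 : is_adjoint ipH V2 V2s).
Hypotheses (adjW1 : is_adjoint ipK W1 W1s) (adjW2 : is_adjoint ipK W2 W2s).
Hypothesis cnpV : compact_normal_pair ipH V1 V2 V1s V2s.
Hypothesis cnpW : compact_normal_pair ipK W1 W2 W1s W2s.
Variables (beta : R[i]) (f : H) (g : K).
Hypothesis evf : joint_eigenvector ipH V1 V2 V1s V2s beta f.
Hypothesis evg : joint_eigenvector ipK W1 W2 W1s W2s beta g.

Local Notation vecH := (orbit_vec V1 V2 f).
Local Notation vecK := (orbit_vec W1 W2 g).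

(* [same_moments] is the annihilator of the vectors [(vecH m n, vecK m n)] for
   the indefinite form [ipH - ipK] on [H * K], and [orbit_graph] is the
   annihilator of [same_moments], hence a closed subspace containing these
   vectors. *)
Definition same_moments (a : H) (b : K) :=
  forall m n, ipH a (vecH m n) = ipK b (vecK m n).

Definition orbit_graph (x : H) (y : K) :=
  forall a b, same_moments a b -> ipH x a = ipK y b.

(** Moved onto the orbit vectors, the operators act by coefficients that depend on [beta] only,
    hence identically on both sides. *)
Lemma same_moments_ops a b : same_moments a b ->
  [/\ same_moments (V1 a) (W1 b), same_moments (V2 a) (W2 b),
      same_moments (V1s a) (W1s b) & same_moments (V2s a) (W2s b)].
Proof.
move=> ab; split => m n.
- rewrite adjV1 adjW1 (orbit_vecV1s hsH adjV1 adjV2 cnpV evf).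
  by rewrite (orbit_vecV1s hsK adjW1 adjW2 cnpW evg) (ipZr hsH) (ipZr hsK) ab.
- rewrite adjV2 adjW2 (orbit_vecV2s hsH adjV1 adjV2 cnpV evf).
  by rewrite (orbit_vecV2s hsK adjW1 adjW2 cnpW evg) (ipZr hsH) (ipZr hsK) ab.
- by rewrite (adjoint_sym hsH adjV1) (adjoint_sym hsK adjW1) !orbit_vecV1 ab.
- rewrite (adjoint_sym hsH adjV2) (adjoint_sym hsK adjW2).
  by rewrite (orbit_vecV2 cnpV) (orbit_vecV2 cnpW) ab.
Qed.

Lemma orbit_graph_ops x y : orbit_graph x y ->
  [/\ orbit_graph (V1 x) (W1 y), orbit_graph (V2 x) (W2 y),
      orbit_graph (V1s x) (W1s y) & orbit_graph (V2s x) (W2s y)].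
Proof.
move=> xy; split=> a b /same_moments_ops[ab1 ab2 ab3 ab4].
- by rewrite adjV1 adjW1; exact: xy.
- by rewrite adjV2 adjW2; exact: xy.
- by rewrite (adjoint_sym hsH adjV1) (adjoint_sym hsK adjW1); exact: xy.
- by rewrite (adjoint_sym hsH adjV2) (adjoint_sym hsK adjW2); exact: xy.
Qed.

Lemma orbit_graph_lin a x y x' y' : orbit_graph x y -> orbit_graph x' y' ->
  orbit_graph (a *: x + x') (a *: y + y').
Proof.
move=> xy xy' b c bc.
by rewrite (ipDl hsH) (ipDl hsK) (ipZl hsH) (ipZl hsK) (xy _ _ bc) (xy' _ _ bc).
Qed.

Lemma orbit_graphB x y x' y' : orbit_graph x y -> orbit_graph x' y' ->
  orbit_graph (x - x') (y - y').
Proof.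
by move=> xy xy' b c bc; rewrite (ipBl hsH) (ipBl hsK) (xy _ _ bc) (xy' _ _ bc).
Qed.

(** Equality of the two Gram matrices, propagated from (f, g) by the isometries. *)
Lemma same_moments_vec m n : same_moments (vecH m n) (vecK m n).
Proof.
have fg : same_moments f g.
  by move=> k l; rewrite (ip_eigenvector_orbit hsH adjV1 adjV2 cnpV evf)
    (ip_eigenvector_orbit hsK adjW1 adjW2 cnpW evg).
elim: m => [|m IHm]; last by case: (same_moments_ops IHm).
by elim: n => [|n IHn] //; case: (same_moments_ops IHn).
Qed.

Lemma orbit_graph_vec : orbit_graph f g.
Proof. by move=> a b /(_ 0%N 0%N) ab; rewrite (ipC hsH) ab -(ipC hsK). Qed.

(** Equal Gram matrices put the orbit pairs in [same_moments]; hence any graph pair lies in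
    [same_moments] too and may serve as a test pair. The relation is thus isometric. *)
Lemma orbit_graph_ip x y x' y' : orbit_graph x y -> orbit_graph x' y' ->
  ipH x x' = ipK y y'.
Proof.
by move=> xy xy'; apply: xy => m n; exact: xy' (same_moments_vec m n).
Qed.

(** The domain of the graph is a closed reducing subspace containing [f]. *)
Lemma orbit_graph_total : irreducible_pair ipH V1 V2 V1s V2s ->
  forall x, exists y, orbit_graph x y.
Proof.
move=> irr; pose M x := exists y, orbit_graph x y.
have [||M0|//] := irr M.
- split.
  + by exists 0 => a b _; rewrite (ip0l hsH) (ip0l hsK).
  + move=> a x x' [y xy] [y' xy']; exists (a *: y + y'); exact: orbit_graph_lin.
  move=> u x Mu ux; have [v uv] := choice Mu.
  (* The graph preserves norms of differences, so the partners [v] of a convergent sequence are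
     Cauchy. *)
  have [y vy] : exists y, cvg_to ipK v y.
    case: (hsK) => _ _ _ _ [complete _]; apply: complete => eps eps0.
    have [N uN] := cvg_cauchy hsH ux eps0; exists N => n m Nn Nm.
    have uvB := orbit_graphB (uv n) (uv m).
    by rewrite -(orbit_graph_ip uvB uvB); exact: uN.
  by exists y => a b ab; apply: (cvg_ip_eq hsH hsK ux vy) => n; exact: uv.
- move=> x [y /orbit_graph_ops[xy1 xy2 xy3 xy4]].
  by split; [exists (W1 y)|exists (W2 y)|exists (W1s y)|exists (W2s y)].
have := M0 f (ex_intro _ g orbit_graph_vec); case: evf => ff _ _ _ _ f0.
by move/eqP: ff; rewrite f0 (ip0l hsH) eq_sym oner_eq0.
Qed.

End EqualEigenvalues.

(** * The intertwining unitary, and invariance of the eigenvalue *)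

Section UnitaryEquivalence.
Variables (R : realType) (H K : lmodType R[i]).
Variables (ipH : H -> H -> R[i]) (ipK : K -> K -> R[i]).
Variables (V1 V2 V1s V2s : H -> H) (W1 W2 W1s W2s : K -> K).
Hypotheses (hsH : hilbert_space ipH) (hsK : hilbert_space ipK).
Hypotheses (adjV1 : is_adjoint ipH V1 V1s) (adjV2 : is_adjoint ipH V2 V2s).
Hypotheses (adjW1 : is_adjoint ipK W1 W1s) (adjW2 : is_adjoint ipK W2 W2s).

Lemma unitarily_equivalent_of_eigenvectors beta f g :
  compact_normal_pair ipH V1 V2 V1s V2s -> compact_normal_pair ipK W1 W2 W1s W2s ->
  irreducible_pair ipH V1 V2 V1s V2s -> irreducible_pair ipK W1 W2 W1s W2s ->
  joint_eigenvector ipH V1 V2 V1s V2s beta f ->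
  joint_eigenvector ipK W1 W2 W1s W2s beta g ->
  unitarily_equivalent ipH ipK V1 V2 W1 W2.
Proof.
move=> cnpV cnpW irrV irrW evf evg.
pose Q := orbit_graph ipH ipK V1 V2 W1 W2 f g.
have Qip x y x' y' : Q x y -> Q x' y' -> ipH x x' = ipK y y'.
  exact: (orbit_graph_ip hsH hsK adjV1 adjV2 adjW1 adjW2 cnpV cnpW evf evg).
have Qops x y : Q x y -> Q (V1 x) (W1 y) /\ Q (V2 x) (W2 y).
  by move=> /(orbit_graph_ops hsH hsK adjV1 adjV2 adjW1 adjW2 cnpV cnpW evf evg)[].
(* An isometric linear relation is single-valued: (0, y - y') lies in it. *)
have Quniq x y y' : Q x y -> Q x y' -> y = y'.
  move=> xy xy'; apply/subr0_eq/(ip_eq0 hsK).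
  have xyB := orbit_graphB hsH hsK xy xy'.
  by rewrite -(Qip _ _ _ _ xyB xyB) subrr (ip0l hsH).
have [U QU] := choice
  (orbit_graph_total hsH hsK adjV1 adjV2 adjW1 adjW2 cnpV cnpW evf evg irrV).
exists U; split.
- move=> a x y; exact: Quniq (QU _) (orbit_graph_lin hsH hsK a (QU x) (QU y)).
- by move=> x y; rewrite (Qip _ _ _ _ (QU x) (QU y)).
(* Surjectivity: the construction is symmetric in the two pairs, and the graph from [K] to [H] is
   the transpose of [Q]. *)
- move=> z; have [x zx] := orbit_graph_total hsK hsH adjW1 adjW2 adjV1 adjV2
    cnpW cnpV evg evf irrW z.
  exists x; apply: (Quniq _ _ _ (QU x)) => a b ab; apply/esym/zx => m n.
  exact/esym/ab.
- by move=> x; exact: Quniq (QU _) (proj1 (Qops _ _ (QU x))).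
- by move=> x; exact: Quniq (QU _) (proj2 (Qops _ _ (QU x))).
Qed.

Lemma eigenvalue_commut_unitary b :
  unitarily_equivalent ipH ipK V1 V2 W1 W2 ->
  Defs.eigenvalue (commut V1 V2s) b -> Defs.eigenvalue (commut W1 W2s) b.
Proof.
move=> [U [linU ipU surjU U1 U2]] [x [x0 xE]].
(* A surjective isometry intertwining V2 and W2 also intertwines their adjoints, hence the
   cross-commutators. *)
have U2s y : U (V2s y) = W2s (U y).
  apply: (ip_inj hsK) => z; have [w <-] := surjU z.
  by rewrite ipU (adjoint_sym hsK adjW2) -U2 ipU (adjoint_sym hsH adjV2).
exists (U x); split.
  by move=> Ux0; apply/x0/(ip_eq0 hsH); rewrite -ipU Ux0 (ip0l hsK).
have U0 : U 0 = 0 by apply: (ip_eq0 hsK); rewrite ipU (ip0l hsH).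
have UB y z : U (y - z) = U y - U z by rewrite addrC -scaleN1r linU scaleN1r addrC.
have -> : b *: U x = U (b *: x) by have := linU b x 0; rewrite U0 !addr0.
by rewrite -xE /commut UB U1 !U2s U1.
Qed.

End UnitaryEquivalence.

Theorem theorem5p3 (R : realType)
    (H : lmodType R[i]) (ipH : H -> H -> R[i])
    (V1 V2 V1s V2s : H -> H)
    (K : lmodType R[i]) (ipK : K -> K -> R[i])
    (W1 W2 W1s W2s : K -> K) :
  hilbert_space ipH -> hilbert_space ipK ->
  is_adjoint ipH V1 V1s -> is_adjoint ipH V2 V2s ->
  is_adjoint ipK W1 W1s -> is_adjoint ipK W2 W2s ->
  three_finite_pair ipH V1 V2 V1s V2s -> irreducible_pair ipH V1 V2 V1s V2s ->
  three_finite_pair ipK W1 W2 W1s W2s -> irreducible_pair ipK W1 W2 W1s W2s ->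
  exists beta beta' : R[i],
    [/\ unique_nonzero_eigenvalue (commut V1 V2s) beta,
        unique_nonzero_eigenvalue (commut W1 W2s) beta' &
        (unitarily_equivalent ipH ipK V1 V2 W1 W2 <-> beta = beta')].
Proof.
move=> hsH hsK adjV1 adjV2 adjW1 adjW2 [cnpV rkV] irrV [cnpW rkW] irrW.
have [b [f evf]] := exists_joint_eigenvector hsH adjV1 adjV2 cnpV rkV.
have [b' [g evg]] := exists_joint_eigenvector hsK adjW1 adjW2 cnpW rkW.
have ub := unique_eigenvalue hsH adjV1 adjV2 cnpV evf irrV rkV.
have ub' := unique_eigenvalue hsK adjW1 adjW2 cnpW evg irrW rkW.
exists b, b'; split => //; split=> [equiv|bb'].
  (* Transported by the unitary, [b] is a nonzero eigenvalue of the second cross-commutator, where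
     uniqueness applies. *)
  case: ub ub' => b0 [ev_b _] [_ [_]]; apply => //.
  exact: eigenvalue_commut_unitary equiv ev_b.
move: evg; rewrite -bb' => evg.
exact: unitarily_equivalent_of_eigenvectors cnpV cnpW irrV irrW evf evg.
Qed.
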